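(* Let $\tau>0$, let $M$ be a diagonal real $N\times N$ matrix with positive diagonal entries, let $A$ be a symmetric positive semidefinite real $N\times N$ matrix partitioned into blocks $A=(A_{\alpha\beta})_{\alpha,\beta=1}^{L}$, and let $F\in\mathbb{R}^N$. Let $A^{(1)}=\mathrm{diag}(A_{11},A_{22},\dots,A_{LL})$ be the block diagonal part of $A$ and $A^{(2)}=A-A^{(1)}$. Let $\mu,\sigma\in\mathbb{R}$ be such that $$\mu\ge\frac12,\qquad \Big(\sigma+\frac{\mu-1}{2}\Big)A^{(1)}\ge\frac{\mu}{2}A^{(2)},$$ and let $(u^n)_{n\ge 0}$ be a sequence in $\mathbb{R}^N$ satisfying the three-level implicit-explicit scheme $$\begin{aligned} M&\left(\mu\,\frac{u^{n+1}-u^n}{\tau}+(1-\mu)\,\frac{u^n-u^{n-1}}{\tau}\right)\\ &+A^{(1)}\left(\Big(\sigma+\mu-\tfrac12\Big)u^{n+1}-\Big(2\sigma+\mu-\tfrac32\Big)u^n+\sigma u^{n-1}\right)\\ &+A^{(2)}\left(\Big(\mu+\tfrac12\Big)u^n-\Big(\mu-\tfrac12\Big)u^{n-1}\right)=F,\qquad n=1,2,\dots \end{aligned}$$ Put $$S^{ImEx}=\frac1\tau\Big(\mu-\frac12\Big)M+\Big(\sigma+\frac{\mu-1}{2}\Big)A^{(1)}-\frac{\mu}{2}A^{(2)} .$$ Then the scheme is stable in the sense that, for every $n\ge 1$, $$\frac14\|u^{n+1}+u^n\|_A^2+\|u^{n+1}-u^n\|_{S^{ImEx}}^2\le\frac14\|u^n+u^{n-1}\|_A^2+\|u^n-u^{n-1}\|_{S^{ImEx}}^2+\frac{\tau}{2}\,\|F\|_{M^{-1}}^2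 .$$
   Context: $(\cdot,\cdot)$ is the Euclidean inner product on $\mathbb{R}^N$. The partition into blocks corresponds to a decomposition $N=N_1+\dots+N_L$, with $A_{\alpha\beta}$ of size $N_\alpha\times N_\beta$ ($L$ is the number of continua). For symmetric matrices, $B\ge C$ means $(Bv,v)\ge(Cv,v)$ for all $v\in\mathbb{R}^N$. For a symmetric positive semidefinite matrix $B$, $\|v\|_B^2:=(Bv,v)$ (a seminorm in general). $\tau$ is the uniform time step and $u^n$ is the approximation at time $t_n=n\tau$ for the semi-discrete system $M\,\partial_t u+Au=F$ obtained from the space discretization of a multicontinuum flow problem. *)

(* Defs.v *)
From HB Require Import structures.
From mathcomp Require Import all_boot all_order all_algebra.
From mathcomp Require Import reals.

Set Implicit Arguments.
Unset Strict Implicit.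
Unset Printing Implicit Defensive.

Import Order.TTheory GRing.Theory Num.Theory.
Local Open Scope ring_scope.

Definition dotp (R : realType) (N : nat) (u v : 'cV[R]_N) : R :=
  \sum_i u i 0 * v i 0.

(* The square of the B-seminorm, as a quadratic form: B is not required to be
   positive semidefinite here. *)
Definition sqnorm (R : realType) (N : nat) (B : 'M[R]_N) (v : 'cV[R]_N) : R :=
  dotp (B *m v) v.

Definition mx_symmetric (R : realType) (N : nat) (B : 'M[R]_N) : Prop :=
  B^T = B.

(* The Loewner order; meant for symmetric matrices. *)
Definition mx_ge (R : realType) (N : nat) (B C : 'M[R]_N) : Prop :=
  forall v : 'cV[R]_N, dotp (B *m v) v >= dotp (C *m v) v.

Definition mx_psd (R : realType) (N : nat) (B : 'M[R]_N) : Prop :=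
  mx_symmetric B /\ mx_ge B 0.

Definition block_diag_part (R : realType) (L : nat) (p : 'I_L -> nat)
    (A : 'M[R]_(\sum_(i < L) p i)) : 'M[R]_(\sum_(i < L) p i) :=
  \mxdiag_(i < L) submxblock A i i.

Definition block_offdiag_part (R : realType) (L : nat) (p : 'I_L -> nat)
    (A : 'M[R]_(\sum_(i < L) p i)) : 'M[R]_(\sum_(i < L) p i) :=
  A - block_diag_part A.

(* Since n starts at 1, u n.-1 never meets the convention 0.-1 = 0. *)
Definition imex_scheme (R : realType) (N : nat) (tau mu sigma : R)
    (M A1 A2 : 'M[R]_N) (F : 'cV[R]_N) (u : nat -> 'cV[R]_N) : Prop :=
  forall n : nat, (1 <= n)%N ->
    M *m (mu *: (tau^-1 *: (u n.+1 - u n))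
          + (1 - mu) *: (tau^-1 *: (u n - u n.-1)))
    + A1 *m ((sigma + mu - 1 / 2) *: u n.+1
             - (2 * sigma + mu - 3 / 2) *: u n
             + sigma *: u n.-1)
    + A2 *m ((mu + 1 / 2) *: u n - (mu - 1 / 2) *: u n.-1)
    = F.

Definition imex_S (R : realType) (N : nat) (tau mu sigma : R)
    (M A1 A2 : 'M[R]_N) : 'M[R]_N :=
  (1 / tau * (mu - 1 / 2)) *: M + (sigma + (mu - 1) / 2) *: A1
  - (mu / 2) *: A2.

(* Main.v *)
Require Import Defs.
From HB Require Import structures.
From mathcomp Require Import all_boot all_order all_algebra.
From mathcomp Require Import reals.
From mathcomp Require Import ring lra.

Set Implicit Arguments.
Unset Strict Implicit.
Unset Printing Implicit Defensive.

Import Order.TTheory GRing.Theory Num.Theory.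
Local Open Scope ring_scope.

(** Write [a = u n.+1 - u n] and [b = u n - u n.-1].  The scheme is equivalent to
      [1/(2 tau) M (a + b) + (mu - 1/2)/2 A (a + b) + S (a - b)
         + 1/4 A (u n.+1 + 2 u n + u n.-1) = F].
    Pairing with [a + b], the [S]-term and the last term become differences of
    squared seminorms by symmetry, the second term is nonnegative, and Young's
    inequality lets the first term absorb [(F, a + b)]. *)

Section DotProduct.
Variables (R : realType) (N : nat).
Implicit Types (u v w x y : 'cV[R]_N) (A B C M : 'M[R]_N) (c : R).

Lemma dotpC u v : dotp u v = dotp v u.
Proof. by apply: eq_bigr => i _; rewrite mulrC. Qed.

Lemma dotpDl u v w : dotp (u + v) w = dotp u w + dotp v w.
Proof. by rewrite -big_split; apply: eq_bigr => i _; rewrite mxE mulrDl. Qed.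

Lemma dotpZl c u v : dotp (c *: u) v = c * dotp u v.
Proof. by rewrite mulr_sumr; apply: eq_bigr => i _; rewrite mxE mulrA. Qed.

Lemma dotpBl u v w : dotp (u - v) w = dotp u w - dotp v w.
Proof. by rewrite -scaleN1r dotpDl dotpZl mulN1r. Qed.

Lemma dotpDr u v w : dotp w (u + v) = dotp w u + dotp w v.
Proof. by rewrite dotpC dotpDl !(dotpC w). Qed.

Lemma dotpZr c u v : dotp v (c *: u) = c * dotp v u.
Proof. by rewrite dotpC dotpZl dotpC. Qed.

Lemma dotpBr u v w : dotp w (u - v) = dotp w u - dotp w v.
Proof. by rewrite dotpC dotpBl !(dotpC w). Qed.

Lemma dotp_mxE u v : dotp u v = (u^T *m v) 0 0.
Proof. by rewrite mxE; apply: eq_bigr => i _; rewrite mxE. Qed.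

Lemma dotp_sym B x y : mx_symmetric B -> dotp (B *m x) y = dotp (B *m y) x.
Proof.
by move=> symB; rewrite (dotpC (B *m y)) !dotp_mxE trmx_mul symB mulmxA.
Qed.

(** The two cross terms cancel by symmetry of [B]. This telescoping identity turns a pairing of
    increments with their sum into a difference of energies. *)
Lemma dotp_sub_add B x y : mx_symmetric B ->
  dotp (B *m (x - y)) (x + y) = sqnorm B x - sqnorm B y.
Proof.
move=> symB; rewrite mulmxBr dotpBl !dotpDr (dotp_sym y x) // /sqnorm; ring.
Qed.

Lemma dotp_add_sub B x y : mx_symmetric B ->
  dotp (B *m (x + y)) (x - y) = sqnorm B x - sqnorm B y.
Proof. by move=> symB; rewrite dotp_sym // dotp_sub_add. Qed.

Lemma sqnorm_ge0 B v : mx_psd B -> 0 <= sqnorm B v.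
Proof.
(* The zero column is written as [0 *: v], so that homogeneity of [dotp] evaluates the lower bound
   to 0. *)
by case=> _ /(_ v); rewrite mul0mx -(scale0r v) dotpZl mul0r.
Qed.

Lemma mx_symmetricD B C :
  mx_symmetric B -> mx_symmetric C -> mx_symmetric (B + C).
Proof. by move=> sB sC; rewrite /mx_symmetric linearD /= sB sC. Qed.

Lemma mx_symmetricZ c B : mx_symmetric B -> mx_symmetric (c *: B).
Proof. by move=> sB; rewrite /mx_symmetric linearZ /= sB. Qed.

Lemma mx_symmetricB B C :
  mx_symmetric B -> mx_symmetric C -> mx_symmetric (B - C).
Proof. by move=> sB sC; rewrite /mx_symmetric linearB /= sB sC. Qed.

Lemma imex_S_sym tau mu sigma M A1 A2 :
  mx_symmetric M -> mx_symmetric A1 -> mx_symmetric A2 ->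
  mx_symmetric (imex_S tau mu sigma M A1 A2).
Proof.
move=> sM s1 s2; apply: mx_symmetricB; last exact: mx_symmetricZ.
by apply: mx_symmetricD; exact: mx_symmetricZ.
Qed.

Lemma diag_mx_gt0_psd M :
  is_diag_mx M -> (forall i, 0 < M i i) -> mx_psd M.
Proof.
move=> /diag_mxP[d ->] d_gt0; split; first exact: tr_diag_mx.
move=> v; rewrite mul0mx -(scale0r v) dotpZl mul0r.
apply: sumr_ge0 => i _; rewrite mul_diag_mx mxE -mulrA.
apply: mulr_ge0; last by rewrite -expr2 sqr_ge0.
by have := d_gt0 i; rewrite mxE eqxx mulr1n => /ltW.
Qed.

Lemma diag_mx_gt0_unit M :
  is_diag_mx M -> (forall i, 0 < M i i) -> M \in unitmx.
Proof.
move=> /diag_mxP[d ->] d_gt0; rewrite unitmxE unitfE det_diag.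
apply/prodf_neq0 => i _.
by have := d_gt0 i; rewrite mxE eqxx mulr1n => /gt_eqF->.
Qed.

(** Weighted Young inequality: with [g = invmx M *m u], expand the nonnegative square
    [sqnorm M (v - c *: g)] and divide by [2 * c]. *)
Lemma dotp_young M c u v : 0 < c -> mx_psd M -> M \in unitmx ->
  dotp u v <= (2 * c)^-1 * sqnorm M v + c / 2 * sqnorm (invmx M) u.
Proof.
move=> c_gt0 psdM unitM; have [symM _] := psdM.
set g := invmx M *m u; have defu : u = M *m g by rewrite mulKVmx.
have -> : sqnorm (invmx M) u = sqnorm M g by rewrite /sqnorm dotpC -/g defu.
have := sqnorm_ge0 (v - c *: g) psdM.
rewrite defu /sqnorm mulmxBr -scalemxAr dotpBl dotpZl !dotpBr !dotpZr.
rewrite (dotp_sym v g) // => sq_ge0.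
(* The gap between the two sides is exactly [(2 * c)^-1] times the expanded square. *)
rewrite -subr_ge0; set rhs := (X in 0 <= X).
suff -> : rhs = (2 * c)^-1 * (dotp (M *m v) v - c * dotp (M *m g) v
    - c * (dotp (M *m g) v - c * dotp (M *m g) g)).
  by apply: mulr_ge0 => //; rewrite invr_ge0; lra.
by rewrite /rhs; field; rewrite gt_eqF.
Qed.

(** Compare the coefficients of [x], [y], [z] under each of [M], [A1], [A2]. On the right the three
    contributions to [A2 *m x] cancel, which matches the explicit treatment of [A2]. *)
Lemma imex_residualE tau mu sigma M A1 A2 x y z : tau != 0 ->
  M *m (mu *: (tau^-1 *: (x - y)) + (1 - mu) *: (tau^-1 *: (y - z)))
  + A1 *m ((sigma + mu - 1 / 2) *: x - (2 * sigma + mu - 3 / 2) *: y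
           + sigma *: z)
  + A2 *m ((mu + 1 / 2) *: y - (mu - 1 / 2) *: z)
  = (2 * tau)^-1 *: (M *m (x - z))
    + ((mu - 1 / 2) / 2) *: ((A1 + A2) *m (x - z))
    + imex_S tau mu sigma M A1 A2 *m ((x - y) - (y - z))
    + 4^-1 *: ((A1 + A2) *m ((x + y) + (y + z))).
Proof.
move=> tau_neq0.
rewrite /imex_S !(mulmxBl, mulmxDl) -!scalemxAl.
rewrite !(mulmxDr, mulmxN, =^~ scalemxAr).
(* Once everything is expanded, the nine products can be arbitrary vectors, so a scalar identity in
   each entry remains. *)
move: (M *m x) (M *m y) (M *m z) (A1 *m x) (A1 *m y) (A1 *m z) (A2 *m x)
  (A2 *m y) (A2 *m z) => *.
apply/colP => i; by rewrite !mxE; field.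
Qed.

(** One time step, with [x], [y], [z] standing for the new, current and previous values; the test
    vector is [x - z]. *)
Lemma imex_energy_step tau mu sigma M A1 A2 F x y z :
  0 < tau -> 1 / 2 <= mu -> mx_psd M -> M \in unitmx ->
  mx_symmetric A1 -> mx_symmetric A2 -> mx_psd (A1 + A2) ->
  M *m (mu *: (tau^-1 *: (x - y)) + (1 - mu) *: (tau^-1 *: (y - z)))
  + A1 *m ((sigma + mu - 1 / 2) *: x - (2 * sigma + mu - 3 / 2) *: y
           + sigma *: z)
  + A2 *m ((mu + 1 / 2) *: y - (mu - 1 / 2) *: z) = F ->
  1 / 4 * sqnorm (A1 + A2) (x + y)
  + sqnorm (imex_S tau mu sigma M A1 A2) (x - y)
  <= 1 / 4 * sqnorm (A1 + A2) (y + z)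
     + sqnorm (imex_S tau mu sigma M A1 A2) (y - z)
     + tau / 2 * sqnorm (invmx M) F.
Proof.
move=> tau_gt0 mu_ge psdM unitM sym1 sym2 psdA schemeF.
set S := imex_S _ _ _ _ _ _.
rewrite (imex_residualE _ _ _ _ _ _ _ _ (lt0r_neq0 tau_gt0)) in schemeF.
have [[symM _] [symA _]] := (psdM, psdA).
have symS : mx_symmetric S by exact: imex_S_sym.
have xz_sum : x - z = (x - y) + (y - z) by rewrite addrA subrK.
have xz_diff : x - z = (x + y) - (y + z) by rewrite opprD addrA addrK.
have S_term : dotp (S *m ((x - y) - (y - z))) (x - z)
    = sqnorm S (x - y) - sqnorm S (y - z).
  by rewrite xz_sum dotp_sub_add.
have A_term : dotp ((A1 + A2) *m ((x + y) + (y + z))) (x - z)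
    = sqnorm (A1 + A2) (x + y) - sqnorm (A1 + A2) (y + z).
  by rewrite xz_diff dotp_add_sub.
have A_ge0 : 0 <= (mu - 1 / 2) / 2 * sqnorm (A1 + A2) (x - z).
  by apply: mulr_ge0; [lra | exact: sqnorm_ge0].
(* The weight [c = tau] makes the [M]-term of Young's bound equal to the [M]-term of the rewritten
   scheme, so the two cancel. *)
have := dotp_young F (x - z) tau_gt0 psdM unitM.
(* Only the [F] inside the pairing is replaced by the scheme; the one in [sqnorm (invmx M) F] stays
   as the source term. *)
rewrite -{1}schemeF !dotpDl !dotpZl S_term A_term.
rewrite -!/(sqnorm _ (x - z)); lra.
Qed.

End DotProduct.

(** Transposition acts block by block on the diagonal, and the transpose of block [(i, i)] of [A] is
    block [(i, i)] of [A^T = A]. *)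
Lemma block_diag_part_sym (R : realType) (L : nat) (p : 'I_L -> nat)
    (A : 'M[R]_(\sum_(i < L) p i)) :
  mx_symmetric A -> mx_symmetric (block_diag_part A).
Proof.
move=> symA; rewrite /mx_symmetric /block_diag_part tr_mxdiag.
by apply: eq_mxdiag => i; rewrite tr_submxblock symA.
Qed.

Theorem theorem4 (R : realType) (L : nat) (p : 'I_L -> nat)
    (tau : R) (M A : 'M[R]_(\sum_(i < L) p i))
    (F : 'cV[R]_(\sum_(i < L) p i)) (mu sigma : R)
    (u : nat -> 'cV[R]_(\sum_(i < L) p i)) :
  0 < tau ->
  is_diag_mx M -> (forall i, 0 < M i i) ->
  mx_psd A ->
  let A1 := block_diag_part A in
  let A2 := block_offdiag_part A in
  mu >= 1 / 2 ->
  mx_ge ((sigma + (mu - 1) / 2) *: A1) ((mu / 2) *: A2) ->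
  imex_scheme tau mu sigma M A1 A2 F u ->
  let S := imex_S tau mu sigma M A1 A2 in
  forall n : nat, (1 <= n)%N ->
    1 / 4 * sqnorm A (u n.+1 + u n) + sqnorm S (u n.+1 - u n)
    <= 1 / 4 * sqnorm A (u n + u n.-1) + sqnorm S (u n - u n.-1)
       + tau / 2 * sqnorm (invmx M) F.
Proof.
move=> tau_gt0 diagM M_gt0 psdA A1 A2 mu_ge _ schemeu S n n_gt0.
have [symA _] := psdA.
have sym1 : mx_symmetric A1 by exact: block_diag_part_sym.
have sym2 : mx_symmetric A2 by exact: mx_symmetricB.
have defA : A1 + A2 = A by rewrite addrC subrK.
have psdM := diag_mx_gt0_psd diagM M_gt0.
have unitM := diag_mx_gt0_unit diagM M_gt0.
have psdA12 : mx_psd (A1 + A2) by rewrite defA.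
have := imex_energy_step tau_gt0 mu_ge psdM unitM sym1 sym2 psdA12
  (schemeu n n_gt0).
by rewrite defA.
Qed.
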